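(* Let $i\ge 3$ and $k\ge 3$ be integers. Then: (a) $g_3(L_i,L_{i+2},L_{i+k})=(4L_i-1)L_{i+2}-L_i$ whenever $k\ge i+5$; (b) $g_3(L_i,L_{i+2},L_{2i+4})=(4F_{i-1}-F_{i-2}-1)L_{i+2}+L_{2i+4}-L_i$; (c) $g_3(L_i,L_{i+2},L_{2i+3})=(4F_{i+1}-1)L_{i+2}-L_i$; (d) $g_3(L_i,L_{i+2},L_{2i+2})=(F_i+2F_{i-3}-1)L_{i+2}+2L_{2i+2}-L_i$; (e) $g_3(L_i,L_{i+2},L_{2i+1})=(F_{i-1}-1)L_{i+2}+3L_{2i+1}-L_i$; (f) $g_3(L_i,L_{i+2},L_{2i})=(2F_{i-3}-1)L_{i+2}+4L_{2i}-L_i$ for $i\ge 4$, and $g_3(L_3,L_5,L_6)=3L_5+2L_6-L_3=69$; (g) if $r=\lfloor (L_i-1)/F_k\rfloor\ge 3$ (equivalently $k\le i-1$), then $$g_3(L_i,L_{i+2},L_{i+k})=\begin{cases}(L_i-rF_k-1)L_{i+2}+(r+3)L_{i+k}-L_i & \text{if } (L_i-rF_k)L_{i+2}\ge F_{k-2}L_i,\\ (F_k-1)L_{i+2}+(r+2)L_{i+k}-L_i & \text{if } (L_i-rF_k)L_{i+2}< F_{k-2}L_i.\end{cases}$$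
   Context: Fibonacci numbers: $F_0=0$, $F_1=1$, $F_n=F_{n-1}+F_{n-2}$. Lucas numbers: $L_0=2$, $L_1=1$, $L_n=L_{n-1}+L_{n-2}$. For positive integers $a_1,\dots,a_l$ with $\gcd(a_1,\dots,a_l)=1$ and an integer $n$, let $d(n;a_1,\dots,a_l)$ be the number of tuples $(x_1,\dots,x_l)$ of nonnegative integers with $a_1x_1+\dots+a_lx_l=n$. For a nonnegative integer $p$, the $p$-Frobenius number $g_p(a_1,\dots,a_l)$ is the largest integer $n$ with $d(n;a_1,\dots,a_l)\le p$.
   Formalization: In (f) the value ''=69'' is an error: 3L_5+2L_6-L_3 = 65, and d(69;4,11,18)=4>3; the theorem states g_3(L_3,L_5,L_6)=3L_5+2L_6-L_3 only. In (g) the remark ''equivalently k ≤ i-1'' is not stated; the condition used is r ≥ 3. *)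

(* Defs.v *)
From mathcomp Require Import all_boot all_order all_algebra.
Set Implicit Arguments. Unset Strict Implicit. Unset Printing Implicit Defensive.
Import Order.TTheory GRing.Theory Num.Theory.

Fixpoint fib (n : nat) : nat :=
  match n with
  | 0 => 0
  | 1 => 1
  | (m.+1 as p).+1 => fib p + fib m
  end.

Fixpoint lucas (n : nat) : nat :=
  match n with
  | 0 => 2
  | 1 => 1
  | (m.+1 as p).+1 => lucas p + lucas m
  end.

(* d(n; a_1,...,a_l): the number of tuples (x_1,...,x_l) of nonnegative
   integers with a_1 x_1 + ... + a_l x_l = n.  For n < 0 there are none.
   For n = m >= 0 and all a_i >= 1, every solution has x_i <= m, so the
   solutions are exactly the tuples x : 'I_l -> 'I_(m+1) counted below. *)
Definition denumerant (a : seq nat) (n : int) : nat :=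
  match n with
  | Posz m =>
      #|[set x : {ffun 'I_(size a) -> 'I_m.+1} |
          \sum_(j < size a) nth 0 a j * x j == m]|
  | Negz _ => 0
  end.

Definition is_pFrobenius (p : nat) (a : seq nat) (g : int) : Prop :=
  [/\ all (fun x => 0 < x) a,
      foldr gcdn 0 a = 1,
      denumerant a g <= p
    & forall n : int, (g < n)%R -> p < denumerant a n].

(* Main.v *)
Require Import Defs.
From mathcomp Require Import all_boot all_order all_algebra.
From mathcomp Require Import zify.
Import Order.TTheory GRing.Theory Num.Theory.
Local Open Scope ring_scope.

(* Put a = L_i, b = L_(i+2), c = L_(i+k), f = F_k and h = F_(k-2); then
   c = f b - h a.  Hence a b-c-combination b y + c z with y + f z = t + j a has
   value b (t + j a) - h a z and residue b t modulo a: the values in a residue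
   class are indexed by the pairs (j, z) with f z <= t + j a.  The 3-Frobenius
   number is -a plus the largest, over all classes t, of the fourth smallest of
   these values, so it is enough to exhibit four small pairs in every class and
   to list the at most three pairs below the extremal value in one class.
   Which pairs come first depends only on the size of f relative to a (and on
   h / b being small), which gives the different cases. *)

Local Open Scope nat_scope.

(** * Counting representations by their last two coordinates *)

Lemma sum_ord3 (a b c m : nat) (x : {ffun 'I_3 -> 'I_m.+1}) :
  \sum_(j < 3) nth 0 [:: a; b; c] j * x j
  = a * x (inord 0) + b * x (inord 1) + c * x (inord 2).
Proof.
rewrite !big_ord_recl big_ord0 addn0 addnA /=.
by congr (_ * x _ + _ * x _ + _ * x _); apply/val_inj; rewrite /= inordK.
Qed.

Lemma denumerant_ge (a b c m : nat) (s : seq (nat * nat)) :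
  0 < a -> 0 < b -> 0 < c -> uniq s ->
  {in s, forall u, exists x, a * x + b * u.1 + c * u.2 = m} ->
  size s <= denumerant [:: a; b; c] m.
Proof.
move=> a0 b0 c0 us sP.
(* The first coordinate is forced by the other two; [inord] loses nothing, since positive
   coefficients keep every coordinate at most [m]. *)
pose sol (u : nat * nat) : {ffun 'I_3 -> 'I_m.+1} :=
  [ffun i : 'I_3 =>
     inord (nth 0 [:: (m - (b * u.1 + c * u.2)) %/ a; u.1; u.2] i)].
have solE u : u \in s ->
    [/\ a * sol u (inord 0) + b * sol u (inord 1) + c * sol u (inord 2) = m,
        sol u (inord 1) = u.1 :> nat & sol u (inord 2) = u.2 :> nat].
  move=> /sP [x xE].
  have -> : sol u (inord 0) = x :> nat.
    rewrite ffunE /= !inordK //=.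
      by rewrite -[in m - _]xE -addnA addnK mulKn.
    by rewrite -[in m - _]xE -addnA addnK mulKn //; nia.
  have -> : sol u (inord 1) = u.1 :> nat by rewrite ffunE /= !inordK //=; nia.
  have -> : sol u (inord 2) = u.2 :> nat by rewrite ffunE /= !inordK //=; nia.
  by [].
rewrite -(size_map sol) /denumerant cardE; apply: uniq_leq_size.
  rewrite map_inj_in_uniq // => u v /solE [_ u1 u2] /solE [_ v1 v2] uv.
  by by rewrite [u]surjective_pairing [v]surjective_pairing -u1 -u2 -v1 -v2 uv.
move=> _ /mapP [u /solE [uE _ _] ->].
by rewrite mem_enum inE sum_ord3 uE.
Qed.

Lemma denumerant_le (a b c m : nat) (s : seq (nat * nat)) :
  0 < a ->
  (forall x y z, a * x + b * y + c * z = m -> (y, z) \in s) ->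
  denumerant [:: a; b; c] m <= size s.
Proof.
move=> a0 sP; rewrite /denumerant cardE.
pose yz (x : {ffun 'I_3 -> 'I_m.+1}) : nat * nat :=
  (x (inord 1) : nat, x (inord 2) : nat).
rewrite -(size_map yz); apply: uniq_leq_size.
  rewrite map_inj_in_uniq ?enum_uniq // => u v.
  rewrite !mem_enum !inE !sum_ord3 => /eqP uE /eqP vE [e1 e2].
  have e0 : u (inord 0) = v (inord 0) :> nat.
    by apply/eqP; rewrite -(eqn_pmul2l a0) -(eqn_add2r (b * v (inord 1)))
      -(eqn_add2r (c * v (inord 2))) -[in X in X == _]e1
      -[in X in X == _]e2 uE vE.
  apply/ffunP => -[[|[|[|//]]] lt_i]; apply/val_inj.
  - by have -> : Ordinal lt_i = inord 0 by apply/val_inj; rewrite /= inordK.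
  - by have -> : Ordinal lt_i = inord 1 by apply/val_inj; rewrite /= inordK.
  - by have -> : Ordinal lt_i = inord 2 by apply/val_inj; rewrite /= inordK.
move=> _ /mapP [u + ->]; rewrite mem_enum inE sum_ord3 => /eqP uE.
exact: sP uE.
Qed.

(** * Congruences modulo [a] and the criterion for a p-Frobenius number *)

Lemma coprime_solve (a b m : nat) :
  0 < a -> coprime a b -> exists2 t, t < a & b * t = m %[mod a].
Proof.
move=> a0 ab.
(* A multiple of [b] congruent to [m] modulo [a], divided by [b]. *)
exists ((chinese a b m 0 %/ b) %% a); first by rewrite ltn_mod.
rewrite modnMmr mulnC divnK.
  by rewrite chinese_modl.
by rewrite /dvdn chinese_modr // mod0n.
Qed.

Lemma coprime_cancel (a b x y u v : nat) :
  coprime a b -> b * x + a * u = b * y + a * v -> x = y %[mod a].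
Proof.
move=> ab; wlog le_yx : x y u v / y <= x => [wl xyE | xyE].
  have [le_yx | /ltnW le_xy] := leqP y x; first exact: wl xyE.
  by rewrite -(wl y x v u).
apply/eqP; rewrite eqn_mod_dvd // -(Gauss_dvdr _ ab).
by apply/dvdnP; exists (v - u); nia.
Qed.

(** With M = b y0 + c z0, the inequalities compare b (t + j a) - h a z with M, subtractions moved
    across. A representation of M - a yields a pair of the class [t0] of value below M, hence in
    [s]. If n > M - a, a pair in the class of n of value at most M has value at most n, being
    congruent to n, and is completed by a multiple of [a]. *)
Lemma is_pFrobenius_window (p a b c f h t0 j0 y0 z0 : nat)
    (s : seq (nat * nat)) :
  [/\ 0 < a, 0 < b, 0 < c, coprime a b & c + h * a = f * b] ->
  t0 < a -> y0 + f * z0 = t0 + j0 * a ->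
  (forall t, t < a -> exists s' : seq (nat * nat),
     [/\ uniq s', p < size s' & all (fun u =>
       (f * u.2 <= t + u.1 * a) &&
       (b * (t + u.1 * a) + h * a * z0 <= b * (t0 + j0 * a) + h * a * u.2)) s'])
  ->
  size s <= p ->
  (forall j z, f * z <= t0 + j * a ->
     b * (t0 + j * a) + h * a * z0 < b * (t0 + j0 * a) + h * a * z ->
     (j, z) \in s) ->
  is_pFrobenius p [:: a; b; c] ((b * y0 + c * z0)%:Z - a%:Z)%R.
Proof.
case=> a0 b0 c0 ab cE t0a y0E up sp lo; set M := b * y0 + c * z0.
have ME : b * (t0 + j0 * a) = M + h * a * z0.
  by rewrite -y0E /M -addnA -mulnDl cE; lia.
split.
- by rewrite /= a0 b0 c0.
- by rewrite /= gcdn0 gcdnA (eqP ab) gcd1n.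
- case EM: (M%:Z - a%:Z)%R => [m|//]; apply: leq_trans sp.
  rewrite -(size_map (fun u => (t0 + u.1 * a - f * u.2, u.2))).
  apply: denumerant_le => // x y z xyz.
  have yzE : y + f * z = t0 %[mod a].
    (* The [.+1] turns M - a back into M. *)
    have bE : b * (y + f * z) + a * (x.+1 + h * z0)
            = b * t0 + a * (b * j0 + h * z) by nia.
    exact: coprime_cancel bE.
  have [j jE] : exists j, y + f * z = t0 + j * a.
    exists ((y + f * z) %/ a).
    by rewrite {1}(divn_eq (y + f * z) a) yzE modn_small // addnC.
  apply/mapP; exists (j, z) => /=; last by rewrite -jE addnK.
  apply: lo; first lia.
  by rewrite ME addnAC ltn_add2r; nia.
- move=> n gn.
  (* A priori [n] may be negative; [N] is a natural number in its class modulo [a]. *)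
  have [N NE] : exists N : nat, N%:Z = (n + a%:Z * `|n|%:Z)%R.
    by exists `|(n + a%:Z * `|n|%:Z)%R|%N; nia.
  have [t ta tE] := coprime_solve _ _ N a0 ab.
  have [s' [us' ps' s'P]] := up t ta.
  have repP u : u \in s' -> exists x,
      n = (a * x + b * (t + u.1 * a - f * u.2) + c * u.2)%:Z.
    move=> /(allP s'P) /andP [fz].
    rewrite ME addnAC leq_add2r => vM.
    have [w [w' wE]] : exists w w', b * t + a * w = N + a * w'.
      exists (N %/ a), (b * t %/ a).
      have := divn_eq N a; have := divn_eq (b * t) a; rewrite {}tE.
      by move: (N %/ a) (b * t %/ a) (N %% a) => *; lia.
    pose y := t + u.1 * a - f * u.2; pose v := b * y + c * u.2.
    have vE : v + h * a * u.2 = b * (t + u.1 * a).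
      have -> : t + u.1 * a = y + f * u.2 by rewrite subnK.
      by rewrite /v -addnA -mulnDl cE; lia.
    (* The quotient (n - v) / a; it exceeds -1 because [v] is at most M, which is below n + a. *)
    pose q : int := (w%:Z - w'%:Z - `|n|%:Z - b%:Z * u.1%:Z + h%:Z * u.2%:Z)%R.
    have nE : n = (v%:Z + a%:Z * q)%R.
      have : N%:Z = (n + a%:Z * `|n|%:Z)%R by [].
      by rewrite /q; move: `|n| => n' NE'; lia.
    have q0 : (0 <= q)%R.
      have vlM : v <= M by rewrite -(leq_add2r (h * a * u.2)) vE.
      rewrite leNgt; apply/negP => q0.
      have : (a%:Z * q <= a%:Z * -1)%R by rewrite ler_pM2l; lia.
      by move: nE gn; move: (a%:Z * q)%R => aq; lia.
    by exists `|q|%N; rewrite nE /v /y -{1}(gez0_abs q0); lia.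
  (* A single pair of [s'] already represents [n], so [n] is nonnegative. *)
  have [n0 nE] : exists m, n = m%:Z.
    case: s' ps' repP {us' s'P} => // u s' _ /(_ u (mem_head _ _)) [x ->].
    by exists (a * x + b * (t + u.1 * a - f * u.2) + c * u.2).
  rewrite {}nE in repP *; apply: leq_trans ps' _.
  rewrite -(size_map (fun u => (t + u.1 * a - f * u.2, u.2))).
  apply: denumerant_ge => //.
    rewrite map_inj_in_uniq // => -[j z] [j' z'].
    move=> /(allP s'P) /= /andP [jz _] /(allP s'P) /= /andP [jz' _].
    move=> [e1 e2]; rewrite e2 in jz e1 *; congr (_, _).
    have : j * a = j' * a by lia.
    by move/eqP; rewrite eqn_pmul2r // => /eqP.
  move=> _ /mapP [u /repP [x [xE]] ->] /=.
  by exists x.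
Qed.

(* The same criterion for t + 1 and t0 + 1: then q - 1 is the extremal value of
   y + f z, where q is a polynomial without subtraction in the applications. *)
Lemma is_pFrobenius_shifted (p a b c f h q z0 T j0 : nat)
    (s : seq (nat * nat)) (g : int) :
  [/\ 0 < a, 0 < b, 0 < c, coprime a b & c + h * a = f * b] ->
  g = ((q%:Z - f%:Z * z0%:Z - 1) * b%:Z + z0%:Z * c%:Z - a%:Z)%R ->
  0 < T <= a -> f * z0 < q -> T + j0 * a = q ->
  (forall t, 0 < t <= a -> exists s' : seq (nat * nat),
     [/\ uniq s', p < size s' & all (fun u => (f * u.2 < t + u.1 * a) &&
       (b * (t + u.1 * a) + h * a * z0 <= b * q + h * a * u.2)) s']) ->
  size s <= p ->
  (forall j z, f * z < T + j * a ->
     b * (T + j * a) + h * a * z0 < b * q + h * a * z -> (j, z) \in s) ->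
  is_pFrobenius p [:: a; b; c] g.
Proof.
case: T => [|T] // abc -> Ta fq Tq up sp lo.
have [y yE] : exists y, y + f * z0 = T + j0 * a.
  by exists (T + j0 * a - f * z0); lia.
have -> : ((q%:Z - f%:Z * z0%:Z - 1) * b%:Z + z0%:Z * c%:Z
           = (b * y + c * z0)%:Z)%R.
  have -> : (q%:Z - f%:Z * z0%:Z - 1 = y%:Z)%R by lia.
  by lia.
apply: (is_pFrobenius_window _ _ _ _ f h T j0 _ _ s abc) => //.
  move=> t /(up t.+1) [s' [us' ps' s'P]]; exists s'; split=> //.
  apply: sub_all s'P => u; rewrite -Tq !addSn ltnS => /andP [-> /=].
  by rewrite !mulnS -!addnA leq_add2l.
move=> j z; have := lo j z; rewrite -Tq !addSn ltnS !mulnS -!addnA ltn_add2l.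
by [].
Qed.

(** * Fibonacci and Lucas identities *)

Lemma fib_rec n : fib n.+2 = fib n.+1 + fib n. Proof. by []. Qed.

Lemma lucas_rec n : lucas n.+2 = lucas n.+1 + lucas n. Proof. by []. Qed.

Lemma lucas_fib n : lucas n.+1 = fib n.+2 + fib n.
Proof.
elim/ltn_ind: n => -[|[|n]] IH //.
by rewrite lucas_rec (IH n.+1) // (IH n) // !fib_rec; lia.
Qed.

Lemma lucas_gt0 n : 0 < lucas n.
Proof.
elim/ltn_ind: n => -[|[|n]] IH //.
by rewrite lucas_rec addn_gt0 IH.
Qed.

Lemma fib_gt0 n : 0 < fib n.+1.
Proof. by elim: n => // n IH; rewrite fib_rec addn_gt0 IH. Qed.

Lemma leq_fib n : fib n <= fib n.+1.
Proof. by case: n => // n; rewrite fib_rec leq_addr. Qed.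

Lemma leq_lucas m n : 0 < m -> m <= n -> lucas m <= lucas n.
Proof.
move=> m0 /subnK <-; elim: (n - m) => // d IH; apply: leq_trans IH _.
by case: m m0 => // m _; rewrite addSn addnS lucas_rec leq_addr.
Qed.

Lemma coprime_lucas n : coprime (lucas n) (lucas n.+1).
Proof.
elim: n => // n IH.
by rewrite lucas_rec /coprime gcdnDl gcdnC.
Qed.

(** Both sides satisfy the Fibonacci recurrence in [k], so [k = 0] and [k = 1] suffice. This is the
    relation c + h a = f b of the criterion. *)
Lemma lucas_addn i k :
  lucas (i + k.+2) + fib k * lucas i = fib k.+2 * lucas (i + 2).
Proof.
elim/ltn_ind: k => -[|[|k]] IH.
- by rewrite mul0n mul1n addn0.
- by rewrite !addnS addn0 !lucas_rec /=; lia.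
rewrite 2!addnS lucas_rec -!addnS.
have := IH k.+1 (ltnSn _); have := IH k (ltnW (ltnSn _)).
by rewrite (fib_rec k.+2) (fib_rec k) !mulnDl; lia.
Qed.

Lemma lucas_window i k :
  [/\ 0 < lucas i, 0 < lucas (i + 2), 0 < lucas (i + k.+2),
      coprime (lucas i) (lucas (i + 2))
    & lucas (i + k.+2) + fib k * lucas i = fib k.+2 * lucas (i + 2)].
Proof.
split; rewrite ?lucas_gt0 ?lucas_addn //.
by rewrite addn2 lucas_rec /coprime gcdnDr; apply: coprime_lucas.
Qed.

(** With n = i - 3, the numbers a, b, f, h of cases (b) to (f), and of (a) at k = i + 5, are linear
    forms in [x] and [y]; the side conditions become polynomial inequalities in [x <= y]. *)
Lemma fib_lucasE n (x := fib n) (y := fib n.+1) :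
  ((fib n.+2 = (x + y)%N) * (fib n.+3 = (x + 2 * y)%N) *
   (fib n.+4 = (2 * x + 3 * y)%N) * (fib n.+4.+1 = (3 * x + 5 * y)%N) *
   (fib n.+4.+2 = (5 * x + 8 * y)%N) * (fib n.+4.+3 = (8 * x + 13 * y)%N) *
   (fib n.+4.+4 = (13 * x + 21 * y)%N) *
   (lucas n.+3 = (3 * x + 4 * y)%N) *
   (lucas (n.+3 + 2) = (7 * x + 11 * y)%N))%type.
Proof. by rewrite addn2 !lucas_fib !fib_rec -/x -/y; do !split; lia. Qed.

(** * The extremal value, by the size of [f] relative to [a] *)

Section Cases.

Variables (a b c f h : nat) (g : int).
Hypothesis abc :
  [/\ 0 < a, 0 < b, 0 < c, coprime a b & c + h * a = f * b].

(** Raising [j] by 1 costs a b and allows at most [m] more in [z], each saving h a; as m h <= b,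
    such a pair cannot lie below the extremal [(j0, z0)]. *)
Lemma window_tail (m T q j z j0 z0 : nat) :
  m * h <= b -> T + j0 * a = q -> j0 <= j -> z <= z0 + m * (j - j0) ->
  b * (T + j * a) + h * a * z0 < b * q + h * a * z -> False.
Proof.
move=> mb <- /subnK <-; move: (j - j0) => d; rewrite addnK => zle.
have := leq_mul (leqnn (h * a)) zle.
by have := leq_mul mb (leqnn (a * d)); lia.
Qed.

(** A pair with [z > 0] has value at least [c], hence at least the extremal (4 a - 1) b, so only the
    pairs (j, 0) matter and the last class is the worst. *)
Lemma g3_c_large : 4 * a * b <= c + b ->
  g = ((4 * a%:Z - 1) * b%:Z - a%:Z)%R ->
  is_pFrobenius 3 [:: a; b; c] g.
Proof.
have [a0 b0 c0 _ cE] := abc; move=> cb gE.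
apply: (is_pFrobenius_shifted _ _ _ _ f h (4 * a) 0 a 3
  [:: (0, 0); (1, 0); (2, 0)] _ abc) => //; try lia.
- move=> t /andP [t0 ta].
  exists [:: (0, 0); (1, 0); (2, 0); (3, 0)]; split=> //=.
  by have := leq_mul (leqnn b) ta; lia.
- move=> j [|z] fz lt_v; rewrite !inE !xpair_eqE.
    move: lt_v; rewrite ltn_add2r ltn_pmul2l //; nia.
  have := leq_mul (leqnn b) fz.
  have : c <= c * z.+1 by rewrite leq_pmulr.
  have : c * z.+1 + h * a * z.+1 = f * b * z.+1 by rewrite -mulnDl cE.
  by lia.
Qed.

(** In the last class [z = 1] first becomes possible at [j = 3], so (3, 1) comes after (0, 0), (1,
    0), (2, 0). *)
Lemma g3_f_3a_4a : 3 * a <= f -> f < 4 * a -> 2 * h <= b ->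
  h * a + b * f <= b * (4 * a) ->
  g = ((4 * a%:Z - f%:Z - 1) * b%:Z + c%:Z - a%:Z)%R ->
  is_pFrobenius 3 [:: a; b; c] g.
Proof.
have [a0 b0 c0 _ cE] := abc; move=> f_ge f_lt hb hab gE.
have hab' := leq_mul hb (leqnn a).
apply: (is_pFrobenius_shifted _ _ _ _ f h (4 * a) 1 a 3
  [:: (0, 0); (1, 0); (2, 0)] _ abc) => //; try lia.
- move=> t /andP [t0 ta].
  have bta := leq_mul (leqnn b) ta.
  have [ft|tf] := ltnP f (t + 3 * a).
    by exists [:: (0, 0); (1, 0); (2, 0); (3, 1)]; split=> //=; lia.
  exists [:: (0, 0); (1, 0); (2, 0); (3, 0)]; split=> //=.
  by have := leq_mul (leqnn b) tf; lia.
- move=> j z fz lt_v; rewrite !inE !xpair_eqE.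
  have [j3|j3] := leqP 3 j.
    case: (window_tail 2 _ _ j z 3 1 hb _ j3 _ lt_v); first lia.
    rewrite -ltnS -(ltn_pmul2l (_ : 0 < f)); last lia.
    by apply: leq_trans fz _; nia.
  have : z < 1 by rewrite -(ltn_pmul2l (_ : 0 < f)); nia.
  by lia.
Qed.

(** The worst class, f - a, is the largest one without (1, 1); there only (0, 0), (1, 0), (2, 1) can
    lie below (2, 0). *)
Lemma g3_f_a_2a : a < f -> f <= 2 * a -> 2 * h <= b ->
  b * (2 * a) <= h * a + b * f ->
  g = ((f%:Z + a%:Z - 1) * b%:Z - a%:Z)%R ->
  is_pFrobenius 3 [:: a; b; c] g.
Proof.
have [a0 b0 c0 _ cE] := abc; move=> f_gt f_le hb hab gE.
have hab' := leq_mul hb (leqnn a).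
apply: (is_pFrobenius_shifted _ _ _ _ f h (f + a) 0 (f - a) 2
  [:: (0, 0); (1, 0); (2, 1)] _ abc) => //; try lia.
- move=> t /andP [t0 ta].
  have bta := leq_mul (leqnn b) ta.
  have [ft|tf] := ltnP f (t + a).
    by exists [:: (0, 0); (1, 0); (1, 1); (2, 1)]; split=> //=; lia.
  exists [:: (0, 0); (1, 0); (2, 1); (2, 0)]; split=> //=.
  by have := leq_mul (leqnn b) tf; lia.
- move=> j z fz lt_v; rewrite !inE !xpair_eqE.
  have [j3|j3] := leqP 3 j.
    case: (window_tail 2 _ _ j z 2 0 hb _ _ _ lt_v); [lia | lia |].
    rewrite -ltnS -(ltn_pmul2l (_ : 0 < f)); last lia.
    by apply: leq_trans fz _; nia.
  have : z < 2 by rewrite -(ltn_pmul2l (_ : 0 < f)); nia.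
  by case: j j3 fz lt_v => [|[|[|j]]] //; case: z => [|[|z]] //; lia.
Qed.

(** In the last class only (0, 0), (1, 0), (1, 1) can lie below (2, 2), which [2 * f < 3 * a] makes
    available. *)
Lemma g3_f_a_3a2 : a <= f -> 2 * f < 3 * a -> 4 * h <= b ->
  h * a + b * (2 * f) <= b * (3 * a) ->
  g = ((3 * a%:Z - 2 * f%:Z - 1) * b%:Z + 2 * c%:Z - a%:Z)%R ->
  is_pFrobenius 3 [:: a; b; c] g.
Proof.
have [a0 b0 c0 _ cE] := abc; move=> f_ge f_lt hb hab gE.
have hab' := leq_mul hb (leqnn a).
have bf_lt := leq_mul (leqnn b) f_lt.
apply: (is_pFrobenius_shifted _ _ _ _ f h (3 * a) 2 a 2
  [:: (0, 0); (1, 0); (1, 1)] _ abc) => //; try lia.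
- move=> t /andP [t0 ta].
  have bta := leq_mul (leqnn b) ta.
  have [ft|tf] := ltnP (2 * f) (t + 2 * a).
    by exists [:: (0, 0); (1, 0); (1, 1); (2, 2)]; split=> //=; lia.
  have btf := leq_mul (leqnn b) tf.
  have [ft1|tf1] := ltnP f (t + a).
    by exists [:: (0, 0); (1, 0); (1, 1); (2, 1)]; split=> //=; lia.
  have btf1 := leq_mul (leqnn b) tf1.
  by exists [:: (0, 0); (1, 0); (2, 1); (2, 0)]; split=> //=; lia.
- move=> j z fz lt_v; rewrite !inE !xpair_eqE.
  have [j2|j2] := leqP 2 j.
    case: (window_tail 4 _ _ j z 2 2 hb _ _ _ lt_v); [lia | lia |].
    rewrite -ltnS -(ltn_pmul2l (_ : 0 < f)); last lia.
    by apply: leq_trans fz _; nia.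
  have : z < 2 by rewrite -(ltn_pmul2l (_ : 0 < f)); nia.
  by case: j j2 fz lt_v => [|[|j]] //; case: z => [|[|z]] //; lia.
Qed.

(** The worst class, 2 f - a, is the largest one without (1, 2); there only (0, 0), (1, 0), (1, 1)
    can lie below (2, 3). *)
Lemma g3_f_9a14_a : f < a -> 9 * a <= 14 * f -> 7 * h <= b ->
  h * a + b * f <= b * a ->
  g = ((a%:Z - f%:Z - 1) * b%:Z + 3 * c%:Z - a%:Z)%R ->
  is_pFrobenius 3 [:: a; b; c] g.
Proof.
have [a0 b0 c0 _ cE] := abc; move=> f_lt f_ge hb hab gE.
have hab' := leq_mul hb (leqnn a).
have bf_ge := leq_mul (leqnn b) f_ge.
apply: (is_pFrobenius_shifted _ _ _ _ f h (a + 2 * f) 3 (2 * f - a) 2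
  [:: (0, 0); (1, 0); (1, 1)] _ abc) => //; try lia.
- move=> t /andP [t0 ta].
  have bta := leq_mul (leqnn b) ta.
  (* For [f < t] the largest of the four is (1, 1), up to 2 a b - h a; with [7 * h <= b], the ratio
     9/14 is what bounds this by (a + 2 f) b - 3 h a. *)
  have [ft|tf] := ltnP f t.
    by exists [:: (0, 0); (0, 1); (1, 1); (1, 2)]; split=> //=; lia.
  have btf := leq_mul (leqnn b) tf.
  have [ft1|tf1] := ltnP (2 * f) (t + a).
    by exists [:: (0, 0); (1, 0); (1, 1); (1, 2)]; split=> //=; lia.
  have btf1 := leq_mul (leqnn b) tf1.
  have [ft2|tf2] := ltnP (3 * f) (t + 2 * a).
    by exists [:: (0, 0); (1, 0); (1, 1); (2, 3)]; split=> //=; lia.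
  have btf2 := leq_mul (leqnn b) tf2.
  by exists [:: (0, 0); (1, 0); (1, 1); (2, 2)]; split=> //=; lia.
- move=> j z fz lt_v; rewrite !inE !xpair_eqE.
  have [j2|j2] := leqP 2 j.
    case: (window_tail 7 _ _ j z 2 3 hb _ _ _ lt_v); [lia | lia |].
    rewrite -ltnS -(ltn_pmul2l (_ : 0 < f)); last lia.
    by apply: leq_trans fz _; nia.
  have : z < 2 by rewrite -(ltn_pmul2l (_ : 0 < f)); nia.
  by case: j j2 fz lt_v => [|[|j]] //; case: z => [|[|z]] //; lia.
Qed.

(** In the last class (0, 0), (0, 1), (0, 2) precede (1, 4), while [2 * a <= 5 * f] excludes (1,
    5). *)
Lemma g3_f_2a5_a2 : 2 * f < a -> 2 * a <= 5 * f -> 8 * h <= b ->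
  h * a + b * (2 * f) <= b * a ->
  g = ((2 * a%:Z - 4 * f%:Z - 1) * b%:Z + 4 * c%:Z - a%:Z)%R ->
  is_pFrobenius 3 [:: a; b; c] g.
Proof.
have [a0 b0 c0 _ cE] := abc; move=> f_lt f_ge hb hab gE.
have hab' := leq_mul hb (leqnn a).
have bf_lt := leq_mul (leqnn b) f_lt.
apply: (is_pFrobenius_shifted _ _ _ _ f h (2 * a) 4 a 1
  [:: (0, 0); (0, 1); (0, 2)] _ abc) => //; try lia.
- move=> t /andP [t0 ta].
  have bta := leq_mul (leqnn b) ta.
  have [ft|tf] := ltnP (2 * f) t.
    by exists [:: (0, 0); (0, 1); (0, 2); (1, 4)]; split=> //=; lia.
  have btf := leq_mul (leqnn b) tf.
  have [ft1|tf1] := ltnP f t.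
    have [ft2|tf2] := ltnP (4 * f) (t + a).
      by exists [:: (0, 0); (0, 1); (1, 3); (1, 4)]; split=> //=; lia.
    have btf2 := leq_mul (leqnn b) tf2.
    by exists [:: (0, 0); (0, 1); (1, 2); (1, 3)]; split=> //=; lia.
  have btf1 := leq_mul (leqnn b) tf1.
  have [ft2|tf2] := ltnP (3 * f) (t + a).
    by exists [:: (0, 0); (1, 1); (1, 2); (1, 3)]; split=> //=; lia.
  have btf2 := leq_mul (leqnn b) tf2.
  by exists [:: (0, 0); (1, 0); (1, 1); (1, 2)]; split=> //=; lia.
- move=> j z fz lt_v; rewrite !inE !xpair_eqE.
  have [j1|j1] := leqP 1 j.
    case: (window_tail 8 _ _ j z 1 4 hb _ _ _ lt_v); [lia | lia |].
    rewrite -ltnS -(ltn_pmul2l (_ : 0 < f)); last lia.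
    by apply: leq_trans fz _; nia.
  have : z < 3 by rewrite -(ltn_pmul2l (_ : 0 < f)); nia.
  by lia.
Qed.

(** Two classes compete: 3 f, where (0, 3) is just missing and (1, r + 3) is extremal, and 3 f - s,
    where (1, r + 3) is just missing and (1, r + 2) is extremal. [T], [q], [z0] describe either; the
    two inequalities in [b] bound both candidates by the chosen one. *)
Lemma g3_f_le_a3 (r s q z0 T : nat) :
  3 <= r -> 0 < s <= f -> r * f + s = a -> 2 * h <= f -> 2 * a <= b ->
  0 < T <= 3 * f -> T + a = q -> f * z0 < q <= f * z0 + f ->
  b * ((r + 3) * f) + h * a * z0 <= b * q + h * a * (r + 2) ->
  b * ((r + 3) * f + s) + h * a * z0 <= b * q + h * a * (r + 3) ->
  g = ((q%:Z - f%:Z * z0%:Z - 1) * b%:Z + z0%:Z * c%:Z - a%:Z)%R ->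
  is_pFrobenius 3 [:: a; b; c] g.
Proof.
have [a0 b0 c0 _ cE] := abc; move=> r3 sf aE hf ab Tf Tq qf U0 U1 gE.
have f0 : 0 < f by lia.
have rf : 3 * f <= r * f by rewrite leq_mul2r r3 orbT.
have hab : 4 * (h * a) <= b * f.
  by have := leq_mul hf ab; lia.
apply: (is_pFrobenius_shifted _ _ _ _ f h q z0 T 1
  [:: (0, 0); (0, 1); (0, 2)] _ abc) => //; try lia.
- move=> t /andP [t0 ta].
  have bta := leq_mul (leqnn b) ta; rewrite -[in X in _ <= X]aE in bta.
  have [ft3|tf3] := ltnP (3 * f) t.
    (* [w + 3] is the largest [z] possible at [j = 0]; the four largest are used, and (0, w) has the
       largest value. *)
    have [w [wt tw]] : exists w, f * (w + 3) < t /\ t <= f * (w + 4).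
      have q3 : 3 <= t.-1 %/ f by rewrite leq_divRL //; lia.
      exists (t.-1 %/ f - 3); rewrite subnK // (_ : _ + 4 = (t.-1 %/ f).+1).
        have := leq_trunc_div t.-1 f; have := ltn_ceil t.-1 f0.
        by rewrite ![_ * f]mulnC; lia.
      by lia.
    exists [:: (0, w); (0, w + 1); (0, w + 2); (0, w + 3)]; split=> //=.
      by rewrite !inE !xpair_eqE; lia.
    (* The candidate of the class 3 f already bounds (0, w). *)
    suff : b * t + h * a * (r + 3) <= b * ((r + 3) * f + s) + h * a * w by lia.
    have [wr|rw] := leqP (w + 4) r.
      have btw := leq_mul (leqnn b) tw.
      move: wr => /subnK rE; rewrite -rE; move: (r - (w + 4)) => e.
      have := leq_mul hab (leqnn e); lia.
    have wr : w + 3 <= r.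
      by rewrite -ltnS -(ltn_pmul2l f0); apply: leq_trans wt _; lia.
    have rE : r = w + 3 by lia.
    by move: bta; rewrite rE; lia.
  have habr := leq_mul hab (leqnn r).
  have ha3 := leq_mul (leqnn (h * a)) r3.
  have btf3 := leq_mul (leqnn b) tf3.
  have [ft2|tf2] := ltnP (2 * f) t.
    have [ft|tf] := ltnP ((r + 3) * f) (t + a).
      by exists [:: (0, 0); (0, 1); (0, 2); (1, r + 3)]; split=> //=; lia.
    have btf := leq_mul (leqnn b) tf.
    by exists [:: (0, 0); (0, 1); (0, 2); (1, r + 2)]; split=> //=; lia.
  have btf2 := leq_mul (leqnn b) tf2.
  have [ft1|tf1] := ltnP f t.
    exists [:: (0, 0); (0, 1); (1, r); (1, r + 1)]; split=> //=; last lia.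
    by rewrite !inE !xpair_eqE; lia.
  have btf1 := leq_mul (leqnn b) tf1.
  exists [:: (0, 0); (1, r - 2); (1, r - 1); (1, r)]; split=> //=.
    by rewrite !inE !xpair_eqE; lia.
  by move: r3 => /subnK rE; lia.
- move=> j z fz lt_v; rewrite !inE !xpair_eqE.
  have [j1|j1] := leqP 1 j.
    (* Each further [j] admits at most [r + 1] more in [z], as a <= (r + 1) f. *)
    have rb : (r + 1) * h <= b.
      by have := leq_mul (leqnn r) hf; lia.
    case: (window_tail (r + 1) _ _ j z 1 z0 rb _ _ _ lt_v); [lia | lia |].
    rewrite -ltnS -(ltn_pmul2l f0).
    apply: leq_trans fz _; move: j1 => /subnK <-.
    rewrite addnK; move: (j - 1) => d.
    have : a <= (r + 1) * f by lia.
    by move=> /(leq_mul (leqnn d)); lia.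
  have : z < 3 by rewrite -(ltn_pmul2l f0); move: fz; rewrite (_ : j = 0); lia.
  by lia.
Qed.

End Cases.

Local Close Scope nat_scope.

(** * Specialization to Lucas numbers *)

Theorem theorem8 (i k : nat) (hi : (3 <= i)%N) (hk : (3 <= k)%N) :
  let F n := (fib n)%:Z in
  let L n := (lucas n)%:Z in
  let g3 c v := is_pFrobenius 3 [:: lucas i; lucas (i + 2)%N; c] v in
  (* (a) *)
  ((i + 5 <= k)%N ->
     g3 (lucas (i + k)%N) ((4 * L i - 1) * L (i + 2)%N - L i)) /\
  (* (b) *)
  g3 (lucas (2 * i + 4)%N)
     ((4 * F (i - 1)%N - F (i - 2)%N - 1) * L (i + 2)%N + L (2 * i + 4)%N - L i) /\
  (* (c) *)
  g3 (lucas (2 * i + 3)%N) ((4 * F (i + 1)%N - 1) * L (i + 2)%N - L i) /\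
  (* (d) *)
  g3 (lucas (2 * i + 2)%N)
     ((F i + 2 * F (i - 3)%N - 1) * L (i + 2)%N + 2 * L (2 * i + 2)%N - L i) /\
  (* (e) *)
  g3 (lucas (2 * i + 1)%N)
     ((F (i - 1)%N - 1) * L (i + 2)%N + 3 * L (2 * i + 1)%N - L i) /\
  (* (f) *)
  ((4 <= i)%N ->
     g3 (lucas (2 * i)%N)
        ((2 * F (i - 3)%N - 1) * L (i + 2)%N + 4 * L (2 * i)%N - L i)) /\
  is_pFrobenius 3 [:: lucas 3; lucas 5; lucas 6]
     (3 * L 5%N + 2 * L 6%N - L 3%N) /\
  (* (g) *)
  (let r := ((lucas i - 1) %/ fib k)%N in
   (3 <= r)%N ->
   ((L i - r%:Z * F k) * L (i + 2)%N >= F (k - 2)%N * L i ->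
      g3 (lucas (i + k)%N)
         ((L i - r%:Z * F k - 1) * L (i + 2)%N + (r%:Z + 3) * L (i + k)%N - L i)) /\
   ((L i - r%:Z * F k) * L (i + 2)%N < F (k - 2)%N * L i ->
      g3 (lucas (i + k)%N)
         ((F k - 1) * L (i + 2)%N + (r%:Z + 2) * L (i + k)%N - L i))).
Proof.
move=> F L g3; have [n iE] : exists n, i = n.+3%N by exists (i - 3)%N; lia.
have y0 := fib_gt0 n; have xy := leq_fib n; have nE := fib_lucasE n.
have W (j m : nat) : (j = i + m.+2)%N ->
    [/\ (0 < lucas i)%N, (0 < lucas (i + 2))%N, (0 < lucas j)%N,
      coprime (lucas i) (lucas (i + 2))
    & (lucas j + fib m * lucas i = fib m.+2 * lucas (i + 2))%N].
  by move=> ->; apply: lucas_window.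
rewrite {}/g3 {}/L {}/F.
split; [|split; [|split; [|split; [|split; [|split; [|split]]]]]].
- move=> ik; have ik2 : (2 <= k)%N by lia.
  apply: (g3_c_large _ _ _ _ _ _ (W _ (k - 2)%N _)) => //; first by lia.
  (* [n.+4.+4] is i + 5, the tightest case; larger [k] follow by monotonicity. *)
  have : (lucas (i + n.+4.+4) <= lucas (i + k))%N by apply: leq_lucas; lia.
  have [_ _ _ _] := W _ n.+4.+2%N erefl.
  by rewrite iE !nE; clear -y0 xy; nia.
- by apply: (g3_f_3a_4a _ _ _ _ _ _ (W _ n.+3.+2%N _));
    rewrite iE ?subSS ?subn0 ?nE; clear -y0 xy; nia.
- by apply: (g3_f_a_2a _ _ _ _ _ _ (W _ n.+4%N _));
    rewrite iE ?addn1 ?nE; clear -y0 xy; nia.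
- by apply: (g3_f_a_3a2 _ _ _ _ _ _ (W _ n.+3%N _));
    rewrite iE ?subSS ?subn0 ?nE; clear -y0 xy; nia.
- by apply: (g3_f_9a14_a _ _ _ _ _ _ (W _ n.+2%N _));
    rewrite iE ?subSS ?subn0 ?nE; clear -y0 xy; nia.
(* F_(i-2) <= 2 F_(i-3) and F_(i-3) > 0 both need i >= 4. *)
- move=> i4; have yx : (fib n.+1 <= 2 * fib n)%N.
    have -> : n = n.-1.+1%N by lia.
    by rewrite fib_rec; have := leq_fib n.-1; lia.
  have x0 : (0 < fib n)%N by lia.
  by apply: (g3_f_2a5_a2 _ _ _ _ _ _ (W _ n.+1%N _));
    rewrite iE ?subSS ?subn0 ?nE; clear -y0 xy x0 yx; nia.
(* For i = 3 one has 2 f = a, so (0, 2) is missing in the class 4; (1, 3) takes its place before the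
   extremal (1, 2), and the value is 65. *)
- apply: (is_pFrobenius_shifted 3 4 11 18 2 1 8 2 4 1
    [:: (0, 0); (0, 1); (1, 3)]%N 65) => //.
    move=> [|[|[|[|[|t]]]]] // _.
    + by exists [:: (0, 0); (1, 0); (1, 1); (1, 2)]%N.
    + by exists [:: (0, 0); (1, 0); (1, 1); (1, 2)]%N.
    + by exists [:: (0, 0); (0, 1); (1, 2); (1, 3)]%N.
    + by exists [:: (0, 0); (0, 1); (1, 2); (1, 3)]%N.
  by move=> j z; rewrite !inE !xpair_eqE /=; lia.
have [m kE] : exists m, k = m.+2%N by exists (k - 2)%N; lia.
set r := (_ %/ _)%N => r3; have := W (i + k)%N m; rewrite -kE => /(_ erefl) ikW.
set f := fib k in r r3 ikW *; set h := fib m in ikW.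
have -> : fib (k - 2) = h by rewrite kE !subSS subn0.
have f0 : (0 < f)%N by rewrite /f kE fib_gt0.
have hf : (2 * h <= f)%N by rewrite /f kE fib_rec; have := leq_fib m; lia.
have ab : (2 * lucas i <= lucas (i + 2))%N by rewrite iE !nE; lia.
(* As [r] is the quotient of a - 1, the remainder [s] of [a] runs from 1 to f. *)
have [s sf aE] : exists2 s, (0 < s <= f)%N & (r * f + s = lucas i)%N.
  have := divn_eq (lucas i - 1) f; have := ltn_pmod (lucas i - 1) f0.
  rewrite -/r; have [a0 _ _ _ _] := ikW.
  by exists ((lucas i - 1) %% f).+1%N; lia.
have r3f : (3 * f <= r * f)%N by rewrite leq_mul2r r3 orbT.
have -> : (lucas i)%:Z - r%:Z * f%:Z = s%:Z by lia.
(* The candidates of the classes 3 f and 3 f - s differ by s b - h a, whose sign selects the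
   class. *)
split=> sh.
  by apply: (g3_f_le_a3 _ _ _ _ _ _ ikW r s ((r + 3) * f + s) (r + 3) (3 * f)) => //; lia.
by apply: (g3_f_le_a3 _ _ _ _ _ _ ikW r s ((r + 3) * f) (r + 2) (3 * f - s)) => //; lia.
Qed.
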